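(* Let $\mathcal{G}=(\mathcal{N},\mathcal{E})$ be a communication network of agents (directed and possibly disconnected), let $\mathcal{V}_i$ ($i\in\mathcal{N}$) be the agents' finite action sets, let $\mathcal{V}=\bigcup_{i\in\mathcal{N}}\mathcal{V}_i$, and let $f:2^{\mathcal{V}}\to\mathbb{R}$ be normalized, non-decreasing submodular, and 2nd-order submodular. Let $\mathcal{S}^{\mathrm{RAG}}=\{s_i^{\mathrm{RAG}}\}_{i\in\mathcal{N}}$ be the output, over all agents, of the algorithm RAG described in the context, and let $\mathcal{S}^{\mathrm{OPT}}\in\arg\max_{s_i\in\mathcal{V}_i,\ \forall i\in\mathcal{N}} f(\{s_i\}_{i\in\mathcal{N}})$. Then RAG selects $\mathcal{S}^{\mathrm{RAG}}$ such that $s_i^{\mathrm{RAG}}\in\mathcal{V}_i$ for all $i\in\mathcal{N}$, and $$f(\mathcal{S}^{\mathrm{RAG}})\ \ge\ \frac12\Big[f(\mathcal{S}^{\mathrm{OPT}})-\sum_{i\in\mathcal{N}}\mathrm{coin}_i\Big],$$ where, for each $i\in\mathcal{N}$, with $\mathcal{N}_i^c=\mathcal{N}\setminus(\mathcal{N}_i^-\cup\{i\})$ the set of non-neighbors of $i$, $$\mathrm{coin}_i=\max_{s_i\in\mathcal{V}_i}\ \max_{s_j\in\mathcal{V}_j,\ \forall j\in\mathcal{N}_i^c}\Big[f(\{s_i\})-f\big(s_i\,|\,\{s_j\}_{j\in\mathcal{N}_i^c}\big)\Big].$$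
   Context: Notation. The network $\mathcal{G}=(\mathcal{N},\mathcal{E})$ is fixed during the execution of the algorithm. $\mathcal{N}_i^-=\{j\in\mathcal{N}:(j,i)\in\mathcal{E}\}$ is the set of in-neighbors of $i$ and $\mathcal{N}_i^+=\{j\in\mathcal{N}:(i,j)\in\mathcal{E}\}$ the set of out-neighbors. For $s\in\mathcal{V}$ and $\mathcal{A}\subseteq\mathcal{V}$, the marginal gain is $f(s\,|\,\mathcal{A})=f(\mathcal{A}\cup\{s\})-f(\mathcal{A})$. If $\mathcal{N}_i^c=\emptyset$, then $\mathrm{coin}_i=0$. Function classes. $f:2^{\mathcal{V}}\to\mathbb{R}$ is normalized and non-decreasing submodular if $f(\emptyset)=0$; $f(\mathcal{A})\le f(\mathcal{B})$ whenever $\mathcal{A}\subseteq\mathcal{B}\subseteq\mathcal{V}$; and $f(s\,|\,\mathcal{A})\ge f(s\,|\,\mathcal{B})$ whenever $\mathcal{A}\subseteq\mathcal{B}\subseteq\mathcal{V}$ and $s\in\mathcal{V}$. It is 2nd-order submodular if $f(s\,|\,\mathcal{C})-f(s\,|\,\mathcal{A}\cup\mathcal{C})\ge f(s\,|\,\mathcal{B}\cup\mathcal{C})-f(s\,|\,\mathcal{A}\cup\mathcal{B}\cup\mathcal{C})$ for all (pairwise) disjoint $\mathcal{A},\mathcal{B},\mathcal{C}\subseteq\mathcal{V}$ and all $s\in\mathcal{V}$. Algorithm RAG (Resource-Aware distributed Greedy), run by every agent with synchronous communication. Agent $i$ keeps a set $\mathcal{I}_i$ (the agents in $\mathcal{N}_i^-$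 that have selected an action) and a set $\mathcal{S}_i$ (the actions selected by the agents in $\mathcal{I}_i$), both initially empty. While agent $i$ has not selected an action $s_i^{\mathrm{RAG}}$, it repeats the following iteration: (1) $s_i\leftarrow\arg\max_{y\in\mathcal{V}_i}[f(\mathcal{S}_i\cup\{y\})-f(\mathcal{S}_i)]$ and $g_i\leftarrow f(\mathcal{S}_i\cup\{s_i\})-f(\mathcal{S}_i)$; (2) transmit $g_i$ to each agent in $\mathcal{N}_i^+\setminus\mathcal{I}_i$ and receive $g_j$ from each $j\in\mathcal{N}_i^-\setminus\mathcal{I}_i$; (3) if $i=\arg\max_{j\in(\mathcal{N}_i^-\cup\{i\})\setminus\mathcal{I}_i} g_j$, select $s_i^{\mathrm{RAG}}\leftarrow s_i$ and transmit $s_i$ to each agent in $\mathcal{N}_i^+\setminus\mathcal{I}_i$; (4) otherwise, let $\mathcal{I}_i^{\mathrm{new}}$ be the (possibly empty) set of agents $j\in\mathcal{N}_i^-\setminus\mathcal{I}_i$ that selected an action in this iteration, receive $s_j^{\mathrm{RAG}}$ from each $j\in\mathcal{I}_i^{\mathrm{new}}$, and set $\mathcal{I}_i\leftarrow\mathcal{I}_i\cup\mathcal{I}_i^{\mathrm{new}}$, $\mathcal{S}_i\leftarrow\mathcal{S}_i\cup\{s_j^{\mathrm{RAG}}\}_{j\in\mathcal{I}_i^{\mathrm{new}}}$. Agent $i$ returns $s_i^{\mathrm{RAG}}$. No rule for breaking ties in the argmax operations is specified.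
   Formalization: Ties between agents' gains in step (3) are broken by an arbitrary total order common to all agents in an iteration (it may vary between iterations); with independent tie-breaking, mutual neighbors could all select the same action at once and the bound would fail, or agents could wait forever. *)

(* Defs.v *)
From mathcomp Require Import all_boot all_order all_algebra.

Set Implicit Arguments.
Unset Strict Implicit.
Unset Printing Implicit Defensive.

Import Order.TTheory GRing.Theory Num.Theory.
Local Open Scope ring_scope.

Definition marg (R : realFieldType) (V : finType) (f : {set V} -> R)
    (s : V) (A : {set V}) : R :=
  f (A :|: [set s]) - f A.

Definition normalized (R : realFieldType) (V : finType) (f : {set V} -> R) :=
  f set0 = 0.

Definition nondecreasing_set (R : realFieldType) (V : finType)
    (f : {set V} -> R) :=
  forall A B : {set V}, A \subset B -> f A <= f B.

Definition submodular (R : realFieldType) (V : finType) (f : {set V} -> R) :=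
  forall (A B : {set V}) (s : V), A \subset B -> marg f s B <= marg f s A.

Definition submodular2 (R : realFieldType) (V : finType) (f : {set V} -> R) :=
  forall (A B C : {set V}) (s : V),
    [disjoint A & B] -> [disjoint A & C] -> [disjoint B & C] ->
    marg f s (B :|: C) - marg f s (A :|: B :|: C)
      <= marg f s C - marg f s (A :|: C).

(* Throughout, N is the set of agents and e j i means that (j, i) is an edge,
   i.e. that j transmits to i.  A self-loop has no effect anywhere below. *)
Definition in_nbrs (N : finType) (e : rel N) (i : N) : {set N} :=
  [set j | e j i].

Definition non_nbrs (N : finType) (e : rel N) (i : N) : {set N} :=
  ~: (in_nbrs e i :|: [set i]).

Definition feasible (N V : finType) (Vs : N -> {set V}) (s : N -> V) :=
  forall i, s i \in Vs i.

Definition optimal (R : realFieldType) (N V : finType) (f : {set V} -> R)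
    (Vs : N -> {set V}) (o : N -> V) :=
  feasible Vs o /\
  forall s : N -> V, feasible Vs s ->
    f [set s i | i : N] <= f [set o i | i : N].

(* Only the values of a on non_nbrs e i matter.  The seed 0 is harmless: all
   the differences are nonnegative when f is normalized and submodular, so each
   \big[Num.max/0] is the maximum of its range (coin_ub and coin_attained). *)
Definition coin (R : realFieldType) (N V : finType) (e : rel N)
    (f : {set V} -> R) (Vs : N -> {set V}) (i : N) : R :=
  \big[Num.max/0]_(s in Vs i)
   \big[Num.max/0]_(a : {ffun N -> V} |
                     [forall j in non_nbrs e i, a j \in Vs j])
     (f [set s] - marg f s [set a j | j in non_nbrs e i]).

(* Local memories of all the agents: the selected action, if any, and the
   variables I_i and S_i. *)
Record rag_state (N V : finType) := RagState {
  selected : {ffun N -> option V};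
  known_agents : {ffun N -> {set N}};
  known_actions : {ffun N -> {set V}}
}.

Definition rag_init (N V : finType) : rag_state N V :=
  RagState [ffun=> None] [ffun=> set0] [ffun=> set0].

Definition greedy_actions (R : realFieldType) (N V : finType)
    (f : {set V} -> R) (Vs : N -> {set V}) (st : rag_state N V)
    (s : N -> V) :=
  forall i, selected st i = None ->
    s i \in Vs i /\
    forall y, y \in Vs i ->
      marg f y (known_actions st i) <= marg f (s i) (known_actions st i).

Definition total_order (N : finType) (prec : rel N) :=
  [/\ total prec, transitive prec & antisymmetric prec].

(* i is the maximizer of g over A, ties being resolved in favour of the
   prec-least maximizer. *)
Definition argmax_at (R : realFieldType) (N : finType) (prec : rel N)
    (A : {set N}) (g : N -> R) (i : N) : bool :=
  (i \in A) &&
  [forall j in A, (g j < g i) || ((g j == g i) && prec i j)].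

Definition rag_selects (R : realFieldType) (N V : finType) (e : rel N)
    (f : {set V} -> R) (prec : rel N) (st : rag_state N V) (s : N -> V)
    (i : N) : bool :=
  (selected st i == None) &&
  argmax_at prec ((in_nbrs e i :|: [set i]) :\: known_agents st i)
    (fun j => marg f (s j) (known_actions st j)) i.

Definition rag_new (R : realFieldType) (N V : finType) (e : rel N)
    (f : {set V} -> R) (prec : rel N) (st : rag_state N V) (s : N -> V)
    (i : N) : {set N} :=
  [set j in in_nbrs e i :\: known_agents st i | rag_selects e f prec st s j].

(* An agent that has selected an action, in this iteration or before, no longer
   updates its variables. *)
Definition rag_next (R : realFieldType) (N V : finType) (e : rel N)
    (f : {set V} -> R) (prec : rel N) (st : rag_state N V) (s : N -> V) :
    rag_state N V :=
  let sel := rag_selects e f prec st s in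
  let new := rag_new e f prec st s in
  let continues i := (selected st i == None) && ~~ sel i in
  RagState
    [ffun i => if sel i then Some (s i) else selected st i]
    [ffun i => if continues i then known_agents st i :|: new i
               else known_agents st i]
    [ffun i => if continues i then known_actions st i :|: [set s j | j in new i]
               else known_actions st i].

(* One synchronous iteration.  The greedy actions are arbitrary maximizers.
   Ties between the gains of different agents are resolved by an arbitrary
   total order, which may change from one iteration to the next but is common
   to all agents: if every agent could break ties on its own, then agents with
   equal gains could wait for each other forever, or mutual neighbors could
   select simultaneously and the guarantee would fail. *)
Definition rag_step (R : realFieldType) (N V : finType) (e : rel N)
    (f : {set V} -> R) (Vs : N -> {set V}) (st st' : rag_state N V) :=
  exists (s : N -> V) (prec : rel N),
    [/\ greedy_actions f Vs st s, total_order prec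
      & st' = rag_next e f prec st s].

Definition rag_execution (R : realFieldType) (N V : finType) (e : rel N)
    (f : {set V} -> R) (Vs : N -> {set V}) (run : nat -> rag_state N V) :=
  run 0%N = rag_init N V /\ forall t, rag_step e f Vs (run t) (run t.+1).

Definition rag_output (N V : finType) (run : nat -> rag_state N V)
    (s : N -> V) :=
  forall i, exists t, selected (run t) i = Some (s i).

Lemma rag_step_exists (R : realFieldType) (N V : finType) (e : rel N)
    (f : {set V} -> R) (Vs : N -> {set V}) (st : rag_state N V) :
  (forall i, Vs i != set0) -> exists st', rag_step e f Vs st st'.
Proof.
move=> Vs0.
have /fin_all_exists[s sP] : forall i, exists y, y \in Vs i /\
    forall z, z \in Vs i ->
      marg f z (known_actions st i) <= marg f y (known_actions st i).
  move=> i; have /set0Pn[y0 y0P] := Vs0 i.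
  case: (@arg_maxP _ R V y0 (mem (Vs i))
    (fun z => marg f z (known_actions st i)) y0P) => y yP ymax.
  by exists y.
pose prec : rel N := fun i j => (enum_rank i <= enum_rank j)%N.
exists (rag_next e f prec st s), s, prec.
split=> //; split=> [i j|j i k|i j]; rewrite /prec.
- exact: leq_total.
- exact: leq_trans.
- by move=> /anti_leq/val_inj/enum_rank_inj.
Qed.

Lemma gain_loss_ge0 (R : realFieldType) (V : finType) (f : {set V} -> R)
    (s : V) (A : {set V}) :
  normalized f -> submodular f -> 0 <= f [set s] - marg f s A.
Proof.
move=> f0 fS; rewrite subr_ge0; have := fS set0 A s (sub0set A).
by rewrite /marg set0U f0 subr0.
Qed.

Lemma coin_ub (R : realFieldType) (N V : finType) (e : rel N)
    (f : {set V} -> R) (Vs : N -> {set V}) (i : N) (s : V) (a : N -> V) :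
  s \in Vs i -> (forall j, j \in non_nbrs e i -> a j \in Vs j) ->
  f [set s] - marg f s [set a j | j in non_nbrs e i] <= coin e f Vs i.
Proof.
move=> sV aV; apply: (bigmax_sup s) => //.
apply: (bigmax_sup [ffun j => a j]).
  by apply/forall_inP => j jN; rewrite ffunE aV.
by rewrite (eq_imset _ (ffunE a)).
Qed.

Lemma coin_attained (R : realFieldType) (N V : finType) (e : rel N)
    (f : {set V} -> R) (Vs : N -> {set V}) (i : N) :
  normalized f -> submodular f -> (forall j, Vs j != set0) ->
  exists (s : V) (a : N -> V),
    [/\ s \in Vs i, forall j, j \in non_nbrs e i -> a j \in Vs j
      & coin e f Vs i = f [set s] - marg f s [set a j | j in non_nbrs e i]].
Proof.
move=> f0 fS Vs0.
have /fin_all_exists[b bV] : forall j, exists y, y \in Vs j.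
  by move=> j; apply/set0Pn.
have bP : [forall j in non_nbrs e i, [ffun j => b j] j \in Vs j].
  by apply/forall_inP => j _; rewrite ffunE.
have max0 (I : finType) (j : I) (P : pred I) (F : I -> R) :
    P j -> (forall k, P k -> 0 <= F k) ->
    exists2 k, P k & \big[Num.max/0]_(k | P k) F k = F k.
  by move=> Pj F0; have [k Pk Fk] := eq_bigmax j P F Pj F0; exists k.
pose loss s (a : {ffun N -> V}) :=
  f [set s] - marg f s [set a j | j in non_nbrs e i].
pose adm (a : {ffun N -> V}) := [forall j in non_nbrs e i, a j \in Vs j].
have [s sV sE] : exists2 s, s \in Vs i &
    coin e f Vs i = \big[Num.max/0]_(a | adm a) loss s a.
  by apply: max0 (bV i) _ => s _; exact: bigmax_ge_id.
have [a /forall_inP aV aE] : exists2 a, adm a &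
    \big[Num.max/0]_(a | adm a) loss s a = loss s a.
  by apply: max0 bP _ => a _; exact: gain_loss_ge0.
by exists s, a; rewrite sE aE.
Qed.

Lemma coin_no_non_nbrs (R : realFieldType) (N V : finType) (e : rel N)
    (f : {set V} -> R) (Vs : N -> {set V}) (i : N) :
  normalized f -> non_nbrs e i = set0 -> coin e f Vs i = 0.
Proof.
move=> f0 N0; rewrite /coin N0.
have max1 (I : finType) (P : pred I) (F : I -> R) :
    (forall k, P k -> F k = 0) -> \big[Num.max/0]_(k | P k) F k = 0.
  by move=> F0; apply: bigmax_eq_id => k /F0 ->.
by apply: (max1) => s _; apply: max1 => a _;
  rewrite imset0 /marg set0U f0 subr0 subrr.
Qed.

(* Main.v *)
(** The gains [g_i] held by the agents that select in one iteration are ordered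
    by the tie-broken comparison, best first; concatenating these orders over
    the iterations lists all the agents.  When [i] is listed, every in-neighbor
    of [i] listed before it selected in an earlier iteration (otherwise [i]
    would not have won against it), hence is known to [i].  So the actions
    listed before [i] and unknown to [i] come from non-neighbors, and 2nd-order
    submodularity bounds the loss of marginal gain they cause by [coin_i].
    Telescoping along the list gives
      [f S^RAG >= \sum_i (f (s_i | S_i) - coin_i)],
    while submodularity and the greedy choice give
      [f S^OPT <= f S^RAG + \sum_i f (s_i | S_i)]. *)

Require Import Defs.
From mathcomp Require Import all_boot all_order all_algebra lra.
Import Order.TTheory GRing.Theory Num.Theory.
Local Open Scope ring_scope.

Set Implicit Arguments.
Unset Strict Implicit.

Lemma marg_imsetU1 (R : realFieldType) (N V : finType) (f : {set V} -> R)
    (a : N -> V) (D : {set N}) (m : N) :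
  f (a @: (D :|: [set m])) = f (a @: D) + marg f (a m) (a @: D).
Proof. by rewrite /marg imsetU imset_set1 addrC subrK. Qed.

Lemma submodular_imsetU (R : realFieldType) (N V : finType)
    (f : {set V} -> R) (A : {set V}) (o : N -> V) (D : {set N}) :
  submodular f -> f (A :|: o @: D) <= f A + \sum_(i in D) marg f (o i) A.
Proof.
move=> fS; have [n le_Dn] := ubnP #|D|; elim: n D le_Dn => // n IHn D.
have [->|[m mD]] := set_0Vmem D; first by rewrite imset0 setU0 big_set0 addr0.
rewrite (cardsD1 m) mD => /IHn le_D'.
rewrite (big_setD1 m mD) /= -[in o @: D](setD1K mD) setUC imsetU imset_set1.
have /(fS _ _ (o m)) := subsetUl A (o @: (D :\ m)); rewrite /marg.
by rewrite -setUA (setUC [set _]) [_ :|: A]setUC; move: le_D'; lra.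
Qed.

Lemma gain_le_coin (R : realFieldType) (N V : finType) (e : rel N)
    (f : {set V} -> R) (Vs : N -> {set V}) (a : N -> V) (i : N)
    (K D : {set N}) :
  normalized f -> submodular f -> submodular2 f -> feasible Vs a ->
  D :\: K \subset non_nbrs e i ->
  marg f (a i) (a @: K) - coin e f Vs i <= marg f (a i) (a @: D).
Proof.
move=> f0 fS fS2 aV sDK.
have le_coin := coin_ub f (aV i) (fun j (_ : j \in non_nbrs e i) => aV j).
set S := a @: K; set T := [set a j | j in _] in le_coin.
have sDST : a @: D \subset (T :\: S) :|: S :|: set0.
  apply/subsetP=> _ /imsetP[j jD ->]; rewrite setU0 in_setU in_setD.
  have [//|ajS] := boolP (a j \in S).
  rewrite orbF; apply/imset_f/(subsetP sDK); rewrite inE jD andbT.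
  by apply: contra ajS => jK; apply: imset_f.
have := fS _ _ (a i) sDST; have := fS _ _ (a i) (subsetDl T S).
have disj0 (A : {set V}) : [disjoint A & set0].
  by rewrite disjoints_subset setC0 subsetT.
have disjTS : [disjoint T :\: S & S].
  by rewrite disjoints_subset subDset setUCr subsetT.
have := fS2 _ _ _ (a i) disjTS (disj0 _) (disj0 _).
rewrite !setU0 {3}/marg set0U f0 subr0.
by move: le_coin; rewrite -/S; lra.
Qed.

Definition beats (R : realFieldType) (N : finType) (prec : rel N) (g : N -> R) :
    rel N :=
  fun i j => (g j < g i) || ((g j == g i) && prec i j).

Lemma beats_total_order (R : realFieldType) (N : finType) (prec : rel N)
    (g : N -> R) :
  total_order prec -> total_order (beats prec g).
Proof.
move=> [tot trans anti]; split=> [i j|j i k|i j]; rewrite /beats.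
- by case: ltgtP => //= _; apply: tot.
- case/orP=> [lt_ji|/andP[/eqP eq_ji ij]] /orP[lt_kj|/andP[/eqP eq_kj jk]].
  + by rewrite (lt_trans lt_kj lt_ji).
  + by rewrite eq_kj lt_ji.
  + by rewrite -eq_ji lt_kj.
  + by rewrite eq_kj eq_ji eqxx (trans j) ?orbT.
- by case: ltgtP => //= _ ij_ji; apply: anti.
Qed.

Lemma total_order_least (N : finType) (r : rel N) (A : {set N}) :
  total_order r -> A != set0 ->
  exists2 m, m \in A & forall j, j \in A -> r m j.
Proof.
move=> [tot trans _] /set0Pn[i0 i0A].
have refl : reflexive r by move=> i; have := tot i i; rewrite orbb.
have [m mA mmin] := extremumP (P := mem A) id refl trans tot i0A.
by exists m.
Qed.

Lemma total_order_greatest (N : finType) (r : rel N) (A : {set N}) :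
  total_order r -> A != set0 ->
  exists2 m, m \in A & forall j, j \in A -> r j m.
Proof.
move=> [tot trans anti]; apply: (@total_order_least _ (fun i j => r j i)).
split=> [i j|j i k rji rkj|i j /andP[rji rij]]; first exact: tot.
- exact: trans rkj rji.
- by apply: anti; rewrite rij.
Qed.

Lemma sum_le_marg_ordered (R : realFieldType) (N V : finType)
    (f : {set V} -> R) (a : N -> V) (r : rel N) (P K : {set N}) (F : N -> R) :
  total_order r ->
  (forall (D : {set N}) (m : N), m \in K -> D \subset K ->
     (forall j, j \in D -> r j m && (j != m)) ->
     F m <= marg f (a m) (a @: (P :|: D))) ->
  f (a @: P) + \sum_(i in K) F i <= f (a @: (P :|: K)).
Proof.
move=> rT; have [n le_Kn] := ubnP #|K|; elim: n K le_Kn => // n IHn K.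
have [->|K0] := eqVneq K set0; first by rewrite big_set0 addr0 setU0.
have [m mK mmax] := total_order_greatest rT K0.
rewrite (cardsD1 m) mK (big_setD1 m mK) /= => /IHn le_K' FK.
rewrite -[in leRHS](setD1K mK) [_ |: _]setUC setUA marg_imsetU1.
have := FK (K :\ m) m mK (subsetDl _ _).
have /[swap] /[apply] : forall j, j \in K :\ m -> r j m && (j != m).
  by move=> j /setD1P[-> /mmax->].
have : f (a @: P) + \sum_(i in K :\ m) F i <= f (a @: (P :|: (K :\ m))).
  apply: le_K' => D m' /setD1P[_ m'K] sDK; apply: FK => //.
  exact: subset_trans sDK (subsetDl _ _).
lra.
Qed.

Definition finished (N V : finType) (st : rag_state N V) : {set N} :=
  [set i | selected st i != None].

Definition agrees (N V : finType) (st : rag_state N V) (a : N -> V) :=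
  forall i y, selected st i = Some y -> y = a i.

Definition known_finished (N V : finType) (e : rel N) (st : rag_state N V) :=
  forall i, known_agents st i \subset finished st :&: in_nbrs e i /\
    (selected st i = None ->
     known_agents st i = finished st :&: in_nbrs e i).

(* [a] is the final output of the run, of which [st] has fixed a part. *)
Record rag_invariant (R : realFieldType) (N V : finType) (e : rel N)
    (f : {set V} -> R) (Vs : N -> {set V}) (a : N -> V) (st : rag_state N V) :
    Prop := RagInvariant {
  known_actionsE : forall i, known_actions st i = a @: known_agents st i;
  selected_greedy : forall i y, i \in finished st -> y \in Vs i ->
    marg f y (known_actions st i) <= marg f (a i) (known_actions st i);
  value_bound :
    \sum_(i in finished st)
       (marg f (a i) (known_actions st i) - coin e f Vs i)
    <= f (a @: finished st)
}.

Section Step.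

Context (R : realFieldType) (N V : finType) (e : rel N)
  (f : {set V} -> R) (Vs : N -> {set V}).

Lemma selected_step (st st' : rag_state N V) (i : N) (y : V) :
  rag_step e f Vs st st' -> selected st i = Some y -> selected st' i = Some y.
Proof.
by move=> [s [prec [_ _ ->]]] sel_i; rewrite ffunE /rag_selects sel_i.
Qed.

Lemma selected_feasible_step (st st' : rag_state N V) (i : N) (y : V) :
  rag_step e f Vs st st' ->
  (forall z, selected st i = Some z -> z \in Vs i) ->
  selected st' i = Some y -> y \in Vs i.
Proof.
move=> [s [prec [gr _ ->]]] selV; rewrite ffunE.
case: ifP => [/andP[/eqP/gr[siV _] _] [<-] //|_]; exact: selV.
Qed.

Lemma finished_next (prec : rel N) (st : rag_state N V) (s : N -> V) :
  finished (rag_next e f prec st s) =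
    finished st :|: [set i | rag_selects e f prec st s i].
Proof.
by apply/setP=> i; rewrite !inE ffunE; case: ifP; rewrite ?orbT ?orbF.
Qed.

Lemma known_finished_step (st st' : rag_state N V) :
  rag_step e f Vs st st' -> known_finished e st -> known_finished e st'.
Proof.
move=> [s [prec [_ _ ->]]] kf i; have [sub_i eq_i] := kf i.
rewrite finished_next !ffunE.
have sub_next : known_agents st i \subset
    (finished st :|: [set j | rag_selects e f prec st s j]) :&: in_nbrs e i.
  exact: subset_trans sub_i (setSI _ (subsetUl _ _)).
case: (boolP (selected st i == None)) => [/eqP sel_i|sel_i] /=; last first.
  by split=> //; case: ifP => // _ sel0; rewrite sel0 in sel_i.
case: (rag_selects e f prec st s i) => /=; first by split.
suff -> : known_agents st i :|: rag_new e f prec st s i =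
  (finished st :|: [set j | rag_selects e f prec st s j]) :&: in_nbrs e i by [].
rewrite eq_i //; apply/setP=> j; rewrite !inE /rag_selects eq_i // !inE.
by case: (selected st j) => [y|] /=; case: (e j i); rewrite ?andbT ?andbF.
Qed.

Lemma finished_step_proper (st st' : rag_state N V) :
  rag_step e f Vs st st' -> known_finished e st ->
  finished st != [set: N] -> finished st \proper finished st'.
Proof.
move=> [s [prec [_ precT ->]]] kf nfin; rewrite finished_next.
set g := fun j => marg f (s j) (known_actions st j).
have [|m] :=
  total_order_least (A := ~: finished st) (beats_total_order g precT).
  by rewrite -setCT (inj_eq (@setC_inj _)).
rewrite !inE negbK => /eqP m_unsel mbest; rewrite properE subsetUl /=.
apply/subsetPn; exists m; last by rewrite inE m_unsel.
have [_ /(_ m_unsel) km] := kf m.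
rewrite !inE /rag_selects m_unsel /= /argmax_at km; apply/andP; split.
  by rewrite !inE m_unsel !eqxx orbT.
apply/forall_inP => j; rewrite !inE => /andP[jk jm]; apply: mbest.
rewrite !inE; case/orP: jm => [ejm|/eqP->]; last by rewrite m_unsel.
by rewrite ejm andbT in jk.
Qed.

Lemma rag_invariant_step (a : N -> V) (st st' : rag_state N V) :
  normalized f -> submodular f -> submodular2 f -> feasible Vs a ->
  rag_step e f Vs st st' -> agrees st' a -> known_finished e st ->
  rag_invariant e f Vs a st -> rag_invariant e f Vs a st'.
Proof.
move=> f0 fS fS2 aV [s [prec [gr precT ->]]] ag kf [kE sg vb].
pose K := [set i | rag_selects e f prec st s i].
have s_a i : i \in K -> s i = a i.
  by rewrite inE => iK; apply: (ag i); rewrite ffunE iK.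
have unsel i : i \in K -> selected st i = None by rewrite inE => /andP[/eqP].
have frozen i : i \in finished st :|: K ->
    known_actions (rag_next e f prec st s) i = known_actions st i.
  rewrite !inE ffunE => /orP[/negPf->//|->]; by rewrite andbF.
split=> [i|i y|].
- rewrite !ffunE; case: ifP => // _.
  rewrite imsetU kE; congr (_ :|: _); apply: eq_in_imset => j.
  by rewrite inE => /andP[_ jK]; apply: s_a; rewrite inE.
- rewrite finished_next => iF; rewrite frozen //.
  move: iF; rewrite in_setU => /orP[iF|iK]; first exact: sg.
  by have [_] := gr i (unsel i iK); rewrite s_a //; apply.
- rewrite finished_next -/K.
  under eq_bigr => i iF do rewrite frozen //.
  have disj : [disjoint finished st & K].
    by rewrite disjoint_sym disjoints_subset; apply/subsetP=> i /unsel;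
      rewrite !inE => ->.
  rewrite (eq_bigl [predU finished st & K]) => [|i]; last by rewrite in_setU.
  rewrite bigU //=.
  set F := fun i => marg f (a i) (known_actions st i) - coin e f Vs i.
  apply: le_trans (_ : f (a @: finished st) + \sum_(i in K) F i <= _).
    by rewrite lerD2r.
  set g := fun j => marg f (s j) (known_actions st j).
  apply: (sum_le_marg_ordered (beats_total_order g precT)) => D m mK sDK best.
  rewrite /F kE; apply: gain_le_coin => //.
  have m_unsel := unsel m mK; have [_ ->] := kf m; last exact: m_unsel.
  apply/subsetP=> j; rewrite !inE negb_and negb_or negbK.
  case/andP=> jNk /orP[jf|jD].
    move: jNk; rewrite (negPf jf) /= => ->; apply/negP=> /eqP jm.
    by move: jf; rewrite jm m_unsel.
  have /andP[jm j_neq_m] := best j jD; rewrite j_neq_m andbT.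
  have /unsel j_unsel := subsetP sDK j jD.
  apply/negP=> ejm; move: mK; rewrite inE => /andP[_ /andP[_ /forall_inP]].
  have [_ ->] := kf m; last exact: m_unsel.
  move=> /(_ j); rewrite !inE j_unsel ejm => /(_ isT) mj.
  have [_ _ anti] := beats_total_order g precT.
  by case/eqP: j_neq_m; apply: anti; rewrite jm.
Qed.

End Step.

Unset Implicit Arguments.

Theorem theorem1 (R : realFieldType) (N V : finType) (e : rel N)
    (Vs : N -> {set V}) (f : {set V} -> R)
    (hV : \bigcup_(i : N) Vs i = [set: V])
    (hf0 : normalized f) (hmono : nondecreasing_set f)
    (hsub : submodular f) (hsub2 : submodular2 f)
    (sOPT : N -> V) (hOPT : optimal f Vs sOPT)
    (run : nat -> rag_state N V) (hrun : rag_execution e f Vs run) :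
  exists sRAG : N -> V,
    [/\ rag_output run sRAG,
        forall i : N, sRAG i \in Vs i
      & f [set sRAG i | i : N] >=
          2^-1 * (f [set sOPT i | i : N] - \sum_(i : N) coin e f Vs i)].
Proof.
have [run0 step] := hrun.
have sel_le t t' i y : (t <= t')%N ->
    selected (run t) i = Some y -> selected (run t') i = Some y.
  move/subnKC <-; elim: (t' - t)%N => [|n IHn]; first by rewrite addn0.
  by move/IHn; rewrite addnS; apply: selected_step.
have feas t i y : selected (run t) i = Some y -> y \in Vs i.
  elim: t y => [|t IHt] y; first by rewrite run0 ffunE.
  exact: selected_feasible_step (step t) IHt.
have kf t : known_finished e (run t).
  elim: t => [|t IHt]; last exact: known_finished_step (step t) IHt.
  rewrite run0 => i; rewrite !ffunE sub0set; split=> // _.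
  by apply/esym/setP=> j; rewrite !inE ffunE.
have progress t : (minn t #|N| <= #|finished (run t)|)%N.
  elim: t => [|t IHt]; first by rewrite min0n.
  have [finT|nfin] := eqVneq (finished (run t)) setT.
    suff -> : finished (run t.+1) = setT by rewrite cardsT geq_minr.
    apply/setP=> i; have := in_setT i; rewrite -finT !inE.
    case E: (selected _ i) => [y|//] _.
    by rewrite (sel_le _ _ _ _ (leqnSn t) E).
  have /proper_card := finished_step_proper (step t) (kf t) nfin.
  apply: leq_trans; apply: leq_trans (_ : (minn t #|N|).+1 <= _)%N; last by [].
  by rewrite -minnSS leq_min geq_minl /= (leq_trans (geq_minr _ _)).
have finT : finished (run #|N|) = setT.
  apply/eqP; rewrite eqEcard subsetT cardsT.
  by have := progress #|N|; rewrite minnn.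
pose a i := odflt (sOPT i) (selected (run #|N|) i).
have selT i : selected (run #|N|) i = Some (a i).
  have := in_setT i; rewrite -finT inE /a; by case: (selected _ i).
have ag t : agrees (run t) a.
  move=> i y sel_y; have := sel_le _ _ _ _ (leq_maxl t #|N|) sel_y.
  by rewrite (sel_le _ _ _ _ (leq_maxr t #|N|) (selT i)) => -[].
have aV : feasible Vs a by move=> i; apply: feas (selT i).
exists a; split=> //; first by move=> i; exists #|N|.
have inv t : rag_invariant e f Vs a (run t).
  elim: t => [|t IHt]; last first.
    exact: rag_invariant_step (step t) (ag t.+1) (kf t) IHt.
  have fin0 : finished (run 0%N) = set0.
    by apply/setP=> i; rewrite run0 !inE ffunE.
  split=> [i|i y|]; rewrite ?fin0 ?inE //; last by rewrite big_set0 imset0 hf0.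
  by rewrite run0 !ffunE imset0.
have [kE sg] := inv #|N|; rewrite finT => vb.
have [oV _] := hOPT.
have imsetTE (b : N -> V) : b @: setT = [set b i | i : N].
  by apply/setP=> y; apply/imsetP/imsetP=> -[i _ ->]; exists i.
have opt_le : f [set sOPT i | i : N] <= f (a @: setT) +
    \sum_i marg f (a i) (known_actions (run #|N|) i).
  apply: le_trans (hmono _ _ (subsetUr (a @: setT) _)) _.
  have := submodular_imsetU (a @: setT) sOPT setT hsub.
  under eq_bigl do rewrite inE.
  rewrite (imsetTE sOPT) => /le_trans; apply; rewrite lerD2l.
  apply: ler_sum => i _.
  apply: le_trans (sg i _ _ (oV i)); last by rewrite finT.
  by apply: hsub; rewrite kE imsetS.
move: vb; under eq_bigl do rewrite inE.
by rewrite sumrB -(imsetTE a); move: opt_le; lra.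
Qed.
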